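(* Let $a_0,a_1,b_0,b_1$ be positive integers and let $c_i=\min\{a_i,b_i\}$ for $i=0,1$. Let $\mathcal M=\mathcal P\times_{\mathcal L}\mathcal Q$ be the fiber product of the $a_0\times a_1$ Clements--Lindström poset $\mathcal P$ and the $b_0\times b_1$ Clements--Lindström poset $\mathcal Q$ over the $c_0\times c_1$ Clements--Lindström poset $\mathcal L$ (included in $\mathcal P$ and $\mathcal Q$ by the identity on exponent vectors). Then $\mathcal M$ is Macaulay if and only if any one of the following holds: (1) $a_0\le b_0$ and $a_1\le b_1$; (2) $b_0\le a_0$ and $b_1\le a_1$; (3) $b_0<a_0$ and $a_1<b_1$ and at least one of: (a) $a_0=b_1$; (b) $b_1<a_0$ and $b_1+b_0\le a_0+a_1$; (c) $a_0<b_1$ and $a_0+a_1\le b_0+b_1$; (4) $a_0<b_0$ and $b_1<a_1$ and at least one of: (a) $b_0=a_1$; (b) $a_1<b_0$ and $a_1+a_0\le b_0+b_1$; (c) $b_0<a_1$ and $b_0+b_1\le a_0+a_1$.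
   Context: For positive integers $d_0,d_1$, the $d_0\times d_1$ Clements--Lindström poset is $\{(i,j)\in\mathbb N^2: i<d_0,\ j<d_1\}$ with componentwise order, ranked by $i+j$. Given rank-preserving inclusions of posets $\iota_A:\mathcal P_C\hookrightarrow\mathcal P_A$, $\iota_B:\mathcal P_C\hookrightarrow\mathcal P_B$, the fiber product $\mathcal P_A\times_{\mathcal P_C}\mathcal P_B$ is the union of $\mathcal P_A$ and $\mathcal P_B$ with the two copies of $\mathcal P_C$ identified, with order relations induced from $\mathcal P_A$ and $\mathcal P_B$. In the present case $\mathcal M$ is the set of $(i,j)\in\mathbb N^2$ with ($i<a_0$ and $j<a_1$) or ($i<b_0$ and $j<b_1$), under componentwise order, ranked by $i+j$. For a ranked poset $\mathcal R$, $\mathcal R_{[d]}$ is the set of elements of rank $d$; for $A\subseteq\mathcal R$ the upper shadow is $\nabla A=\{b: b\text{ covers some }a\in A\}$. Given an additional total order on $\mathcal R$ (not required to be related to the partial order), $\mathrm{Seg}_d\,q$ denotes the set of the $q$ largest elements of $\mathcal R_{[d]}$ in the total order. $\mathcal R$ is Macaulay if there is a total order on $\mathcal R$ such that for every $d$ and every $A\subseteq\mathcal R_{[d]}$: (i) $|\nabla\mathrm{Seg}_d|A||\le|\nabla A|$, and (ii) $\nabla\mathrm{Seg}_d|A|=\mathrm{Seg}_{d+1}|\nabla\mathrm{Seg}_d|A||$. *)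

(* Defs.v *)
From HB Require Import structures.
From mathcomp Require Import all_boot all_order.
Set Implicit Arguments.
Unset Strict Implicit.
Unset Printing Implicit Defensive.
Import Order.TTheory.

Definition covers {d : Order.disp_t} {T : finPOrderType d} (b a : T) : bool :=
  (a < b)%O && ~~ [exists c : T, (a < c)%O && (c < b)%O].

HB.mixin Record isRanked (d : Order.disp_t) T of Order.FinPOrder d T := {
  rk : T -> nat;
  rk_covers : forall a b : T, covers b a -> rk b = (rk a).+1
}.

#[short(type="rankedPosetType")]
HB.structure Definition RankedPoset (d : Order.disp_t) :=
  { T of Order.FinPOrder d T & isRanked d T }.

Section Macaulay.

Variables (d : Order.disp_t) (R : rankedPosetType d).
Implicit Types (A : {set R}) (k q : nat).

Definition level k : {set R} := [set x | rk x == k].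

Definition upper_shadow A : {set R} := [set b | [exists a in A, covers b a]].

(* [tle] is the additional total order. An element belongs to the q largest
   ones of its level iff fewer than q elements of that level are strictly
   larger; if q exceeds the size of the level, the segment is the whole level. *)
Definition Seg (tle : rel R) k q : {set R} :=
  [set x in level k | #|[set y in level k | (y != x) && tle x y]| < q].

Definition macaulay : Prop :=
  exists tle : rel R,
    [/\ total tle, antisymmetric tle, transitive tle &
     forall k A, A \subset level k ->
       #|upper_shadow (Seg tle k #|A|)| <= #|upper_shadow A| /\
       upper_shadow (Seg tle k #|A|)
         = Seg tle k.+1 #|upper_shadow (Seg tle k #|A|)|].

End Macaulay.

Arguments macaulay {d} R.

(* Injectivity follows from [incl_mono] by antisymmetry. *)
Record ranked_incl (d d' : Order.disp_t)
    (C : rankedPosetType d) (A : rankedPosetType d') := RankedIncl {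
  incl_fun :> C -> A;
  incl_mono : {mono incl_fun : x y / (x <= y)%O};
  incl_rk : forall x, rk (incl_fun x) = rk x
}.

Section FiberProduct.

Variables (dA dB dC : Order.disp_t).
Variables (A : rankedPosetType dA) (B : rankedPosetType dB).
Variables (C : rankedPosetType dC).

(* The union of A and B with iA c and iB c identified: the two copies of C are
   represented by the one in A. The carrier does not mention iA, which is
   nevertheless a parameter since the order depends on it. *)
Definition in_fiber (iB : ranked_incl C B) (x : A + B) : bool :=
  if x is inr b then b \notin codom iB else true.

Definition fiber_product (iA : ranked_incl C A) (iB : ranked_incl C B) : Type :=
  {x : A + B | in_fiber iB x}.

Variables (iA : ranked_incl C A) (iB : ranked_incl C B).
Local Notation fiber := (fiber_product iA iB).

HB.instance Definition _ := Finite.on fiber.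

(* The order generated by those of A and B under the identification. *)
Definition fiber_le (x y : fiber) : bool :=
  match sval x, sval y with
  | inl a, inl a' => (a <= a')%O
  | inr b, inr b' => (b <= b')%O
  | inl a, inr b => [exists c, (a <= iA c)%O && (iB c <= b)%O]
  | inr b, inl a => [exists c, (b <= iB c)%O && (iA c <= a)%O]
  end.

Definition fiber_rk (x : fiber) : nat :=
  match sval x with inl a => rk a | inr b => rk b end.

Lemma fiber_le_refl : reflexive fiber_le.
Proof. by case=> [[a|b] ?]; rewrite /fiber_le /= lexx. Qed.

Lemma fiber_le_anti : antisymmetric fiber_le.
Proof.
have mixed a b : b \notin codom iB ->
    [exists c, (a <= iA c)%O && (iB c <= b)%O] ->
    [exists c, (b <= iB c)%O && (iA c <= a)%O] -> False.
  move=> nb /existsP[c /andP[ac cb]] /existsP[c' /andP[bc' c'a]].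
  have c'c : (c' <= c)%O by rewrite -(incl_mono iA) (le_trans c'a).
  move/negP: nb; apply; apply/codomP; exists c; apply/le_anti.
  by rewrite cb (le_trans bc') // incl_mono.
case=> [[a|b] xP] [[a'|b'] yP]; rewrite /fiber_le /= => /andP[xy yx].
- by apply: val_inj => /=; congr inl; apply: le_anti; rewrite xy.
- by case: (mixed _ _ yP xy yx).
- by case: (mixed _ _ xP yx xy).
- by apply: val_inj => /=; congr inr; apply: le_anti; rewrite xy.
Qed.

Lemma fiber_le_trans : transitive fiber_le.
Proof.
move=> [[a1|b1] ?] [[a2|b2] ?] [[a3|b3] ?]; rewrite /fiber_le /=.
- exact: le_trans.
- move=> a21 /existsP[c /andP[a1c cb3]]; apply/existsP; exists c.
  by rewrite (le_trans a21).
- move=> /existsP[c /andP[b2c ca1]] a13; apply/existsP; exists c.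
  by rewrite b2c (le_trans ca1).
- move=> /existsP[c /andP[b2c ca1]] /existsP[c' /andP[a1c' c'b3]].
  rewrite (le_trans b2c) // (le_trans _ c'b3) // incl_mono.
  by rewrite -(incl_mono iA) (le_trans ca1).
- move=> /existsP[c /andP[a2c cb1]] /existsP[c' /andP[b1c' c'a3]].
  rewrite (le_trans a2c) // (le_trans _ c'a3) // incl_mono.
  by rewrite -(incl_mono iB) (le_trans cb1).
- move=> /existsP[c /andP[a2c cb1]] b13; apply/existsP; exists c.
  by rewrite a2c (le_trans cb1).
- move=> b21 /existsP[c /andP[b1c ca3]]; apply/existsP; exists c.
  by rewrite (le_trans b21).
- exact: le_trans.
Qed.

Fact fiber_display : Order.disp_t. Proof. exact: Order.Disp tt tt. Qed.

HB.instance Definition _ :=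
  Order.Le_isPOrder.Build fiber_display fiber
    fiber_le_refl fiber_le_anti fiber_le_trans.

Definition fiber_inl (a : A) : fiber := exist _ (inl a) isT.

Definition fiber_inr (b : B) : fiber :=
  match boolP (b \in codom iB) with
  | AltTrue bC => fiber_inl (iA (iinv bC))
  | AltFalse bnC => exist _ (inr b) bnC
  end.

Lemma fiber_inl_le : {mono fiber_inl : a a' / (a <= a')%O}.
Proof. by []. Qed.

Lemma fiber_inr_incl c : fiber_inr (iB c) = fiber_inl (iA c).
Proof.
rewrite /fiber_inr; case: {-}_ / boolP => [bC|/negP[]]; last exact: codom_f.
by have /(inc_inj (incl_mono iB)) -> := f_iinv bC.
Qed.

Lemma fiber_inr_notin b (bnC : b \notin codom iB) :
  fiber_inr b = exist _ (inr b) bnC.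
Proof.
rewrite /fiber_inr; case: {-}_ / boolP => [bC|bnC']; last exact: val_inj.
by case/negP: (bnC).
Qed.

Lemma fiber_inl_inr_le a b :
  (fiber_inl a <= fiber_inr b)%O = [exists c, (a <= iA c)%O && (iB c <= b)%O].
Proof.
case: (boolP (b \in codom iB)) => [/codomP[c ->]|bnC].
  rewrite fiber_inr_incl fiber_inl_le; apply/idP/existsP => [ac|].
    by exists c; rewrite ac lexx.
  by case=> c' /andP[ac']; rewrite incl_mono -(incl_mono iA); apply: le_trans.
by rewrite (fiber_inr_notin bnC).
Qed.

Lemma fiber_inr_inl_le a b :
  (fiber_inr b <= fiber_inl a)%O = [exists c, (b <= iB c)%O && (iA c <= a)%O].
Proof.
case: (boolP (b \in codom iB)) => [/codomP[c ->]|bnC].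
  rewrite fiber_inr_incl fiber_inl_le; apply/idP/existsP => [ac|].
    by exists c; rewrite ac lexx.
  case=> c' /andP[+ ac']; rewrite incl_mono -(incl_mono iA) => cc'.
  exact: le_trans ac'.
by rewrite (fiber_inr_notin bnC).
Qed.

Lemma fiber_inr_le : {mono fiber_inr : b b' / (b <= b')%O}.
Proof.
move=> b b'; case: (boolP (b \in codom iB)) => [/codomP[c ->]|bnC].
  rewrite fiber_inr_incl fiber_inl_inr_le; apply/existsP/idP => [[c']|cb'].
    by rewrite !incl_mono -(incl_mono iB) => /andP[]; apply: le_trans.
  by exists c; rewrite lexx.
case: (boolP (b' \in codom iB)) => [/codomP[c ->]|b'nC].
  rewrite fiber_inr_incl fiber_inr_inl_le; apply/existsP/idP => [[c']|cb'].
    rewrite !incl_mono -(incl_mono iB) => /andP[bc' c'c].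
    exact: le_trans c'c.
  by exists c; rewrite lexx andbT.
by rewrite (fiber_inr_notin bnC) (fiber_inr_notin b'nC).
Qed.

Lemma fiberP (x : fiber) : (exists a, x = fiber_inl a) \/ (exists b, x = fiber_inr b).
Proof.
case: x => [[a|b] xP]; [left; exists a | right; exists b].
  by apply: val_inj.
by rewrite (fiber_inr_notin xP).
Qed.

Lemma fiber_rk_inl a : fiber_rk (fiber_inl a) = rk a.
Proof. by []. Qed.

Lemma fiber_rk_inr b : fiber_rk (fiber_inr b) = rk b.
Proof.
case: (boolP (b \in codom iB)) => [/codomP[c ->]|bnC].
  by rewrite fiber_inr_incl fiber_rk_inl !incl_rk.
by rewrite (fiber_inr_notin bnC).
Qed.

Lemma fiber_rk_covers (x y : fiber) : covers y x -> fiber_rk y = (fiber_rk x).+1.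
Proof.
have ltA := leW_mono fiber_inl_le; have ltB := leW_mono fiber_inr_le.
have coverA a a' : covers (fiber_inl a') (fiber_inl a) -> rk a' = (rk a).+1.
  rewrite /covers ltA => /andP[aa' /existsP nz]; apply: rk_covers.
  rewrite /covers aa'; apply/existsP => -[z az]; apply: nz.
  by exists (fiber_inl z); rewrite !ltA.
have coverB b b' : covers (fiber_inr b') (fiber_inr b) -> rk b' = (rk b).+1.
  rewrite /covers ltB => /andP[bb' /existsP nz]; apply: rk_covers.
  rewrite /covers bb'; apply/existsP => -[z bz]; apply: nz.
  by exists (fiber_inr z); rewrite !ltB.
have mid (z : fiber) : covers y x -> (x <= z)%O -> (z <= y)%O -> z = x \/ z = y.
  case/andP=> _ /existsP nz; rewrite !le_eqVlt.
  case: eqVneq => [->|_]; first by left.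
  case: eqVneq => [->|_]; first by right.
  by move=> /= xz zy; case: nz; exists z; rewrite xz.
case: (fiberP x) => -[u eqx]; case: (fiberP y) => -[v eqy]; subst x y => yx.
- by rewrite !fiber_rk_inl (coverA _ _ yx).
- have := ltW (andP yx).1; rewrite fiber_inl_inr_le => /existsP[c /andP[uc cv]].
  move: uc cv; rewrite -fiber_inl_le -fiber_inr_le -fiber_inr_incl => uc cv.
  case: (mid _ yx uc cv) => eqz; move: yx; rewrite -eqz.
    by move/coverB; rewrite !fiber_rk_inr.
  by rewrite fiber_inr_incl => /coverA; rewrite !fiber_rk_inl.
- have := ltW (andP yx).1; rewrite fiber_inr_inl_le => /existsP[c /andP[uc cv]].
  move: uc cv; rewrite -fiber_inl_le -fiber_inr_le -fiber_inr_incl => uc cv.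
  case: (mid _ yx uc cv) => eqz; move: yx; rewrite -eqz.
    by rewrite fiber_inr_incl => /coverA; rewrite !fiber_rk_inl.
  by move/coverB; rewrite !fiber_rk_inr.
- by rewrite !fiber_rk_inr (coverB _ _ yx).
Qed.

HB.instance Definition _ :=
  isRanked.Build fiber_display fiber fiber_rk_covers.

End FiberProduct.

(* The d0 x d1 Clements--Lindstrom poset: the product order on exponent vectors. *)
Definition CL (d0 d1 : nat) : Type := 'I_d0 *p 'I_d1.

Section ClementsLindstrom.

Variables (d0 d1 : nat).

HB.instance Definition _ := Order.FinPOrder.on (CL d0 d1).

Definition CL_rk (x : CL d0 d1) : nat := x.1 + x.2.

Lemma CL_leE (x y : CL d0 d1) : (x <= y)%O = (x.1 <= y.1) && (x.2 <= y.2).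
Proof. by []. Qed.

Lemma CL_rk_covers (x y : CL d0 d1) : covers y x -> CL_rk y = (CL_rk x).+1.
Proof.
rewrite /covers => /andP[xy /existsP nz].
have mid (z : CL d0 d1) : x != z -> (x <= z)%O -> (z <= y)%O -> z = y.
  rewrite [(z <= _)%O]le_eqVlt => nxz xz /orP[/eqP //|zy].
  by case: nz; exists z; rewrite lt_neqAle nxz xz.
case: x y xy mid {nz} => [x1 x2] [y1 y2]; rewrite lt_neqAle CL_leE /CL_rk /=.
move=> /andP[ne /andP[xy1 xy2]] mid.
have [lt1|ge1] := ltnP x1 y1.
  suff [<- <-] : (Ordinal (leq_ltn_trans lt1 (ltn_ord y1)), x2) = (y1, y2) by [].
  apply: mid; last by rewrite CL_leE /= lt1.
    by apply/eqP => -[/(congr1 val)] /= /n_Sn.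
  by rewrite CL_leE /= leqnSn leqnn.
have eq1 : x1 = y1 by apply/val_inj/eqP; rewrite eqn_leq xy1.
have lt2 : x2 < y2.
  by rewrite ltn_neqAle xy2 andbT; apply: contraNneq ne => /val_inj->; rewrite eq1.
suff [<- <-] : (x1, Ordinal (leq_ltn_trans lt2 (ltn_ord y2))) = (y1, y2).
  by rewrite /= addnS.
apply: mid; last by rewrite CL_leE /= xy1.
  by apply/eqP => -[/(congr1 val)] /= /n_Sn.
by rewrite CL_leE /= leqnSn leqnn.
Qed.

HB.instance Definition _ := isRanked.Build _ (CL d0 d1) CL_rk_covers.

End ClementsLindstrom.

Section CLInclusion.

Variables (c0 c1 d0 d1 : nat) (le0 : c0 <= d0) (le1 : c1 <= d1).

Definition CL_widen (x : CL c0 c1) : CL d0 d1 :=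
  (widen_ord le0 x.1, widen_ord le1 x.2).

Definition CL_incl : ranked_incl (CL c0 c1) (CL d0 d1) :=
  @RankedIncl _ _ (CL c0 c1) (CL d0 d1) CL_widen
    (fun _ _ => erefl) (fun _ => erefl).

End CLInclusion.

Section Exponents.

Variables (a0 a1 b0 b1 : nat).

Local Notation iP := (CL_incl (geq_minl a0 b0) (geq_minl a1 b1)).
Local Notation iQ := (CL_incl (geq_minr a0 b0) (geq_minr a1 b1)).

Implicit Types x y : fiber_product iP iQ.

(* Exponent vectors identify this fiber product with the set of (i, j) such that
   i < a0 and j < a1, or i < b0 and j < b1, ordered componentwise and ranked by
   i + j. *)
Definition fiber_exp x : nat * nat :=
  match sval x with
  | inl u => (u.1 : nat, u.2 : nat)
  | inr u => (u.1 : nat, u.2 : nat)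
  end.

Lemma CL_codom (u : CL b0 b1) : (u \in codom iQ) = (u.1 < a0) && (u.2 < a1).
Proof.
apply/codomP/andP => [[[c1 c2] ->] /=|[lt1 lt2]].
  by have := ltn_ord c1; have := ltn_ord c2; rewrite !leq_min => /andP[-> _] /andP[-> _].
have lt1' : u.1 < minn a0 b0 by rewrite leq_min lt1 /=.
have lt2' : u.2 < minn a1 b1 by rewrite leq_min lt2 /=.
exists (Ordinal lt1', Ordinal lt2'); case: u {lt1 lt2} lt1' lt2' => u1 u2 lt1 lt2.
by congr pair; apply: val_inj.
Qed.

Lemma fiber_exp_le x y :
  (x <= y)%O = ((fiber_exp x).1 <= (fiber_exp y).1)
               && ((fiber_exp x).2 <= (fiber_exp y).2).
Proof.
case: x y => [[u|u] xP] [[v|v] yP] //; rewrite /fiber_exp /=.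
- transitivity [exists c, (u <= iP c)%O && (iQ c <= v)%O] => //.
  apply/existsP/andP => [[c /andP[]]|[le1 le2]].
    rewrite !CL_leE => /andP[uc1 uc2] /andP[cv1 cv2].
    by rewrite (leq_trans uc1) // (leq_trans uc2).
  have lt1 : u.1 < minn a0 b0 by rewrite leq_min ltn_ord (leq_ltn_trans le1) //=.
  have lt2 : u.2 < minn a1 b1 by rewrite leq_min ltn_ord (leq_ltn_trans le2) //=.
  by exists (Ordinal lt1, Ordinal lt2); rewrite !CL_leE /= !leqnn le1.
- transitivity [exists c, (u <= iQ c)%O && (iP c <= v)%O] => //.
  apply/existsP/andP => [[c /andP[]]|[le1 le2]].
    rewrite !CL_leE => /andP[uc1 uc2] /andP[cv1 cv2].
    by rewrite (leq_trans uc1) // (leq_trans uc2).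
  have lt1 : u.1 < minn a0 b0 by rewrite leq_min ltn_ord (leq_ltn_trans le1) //=.
  have lt2 : u.2 < minn a1 b1 by rewrite leq_min ltn_ord (leq_ltn_trans le2) //=.
  by exists (Ordinal lt1, Ordinal lt2); rewrite !CL_leE /= !leqnn le1.
Qed.

Lemma fiber_exp_inj : injective fiber_exp.
Proof.
by move=> x y eqxy; apply: le_anti; rewrite !fiber_exp_le eqxy !leqnn.
Qed.

Lemma fiber_expP i j :
  (exists x, fiber_exp x = (i, j)) <->
  (i < a0) && (j < a1) || (i < b0) && (j < b1).
Proof.
split=> [[[[u|u] ?] [<- <-]]|]; rewrite ?ltn_ord ?orbT //.
case: (boolP (_ && _)) => [/andP[ia ja] _|nA /andP[ib jb]].
  by exists (fiber_inl iP iQ (Ordinal ia, Ordinal ja)).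
have uP : (Ordinal ib, Ordinal jb) \notin codom iQ by rewrite CL_codom.
by exists (exist _ (inr (Ordinal ib, Ordinal jb)) uP).
Qed.

Lemma fiber_exp_rk x : rk x = (fiber_exp x).1 + (fiber_exp x).2.
Proof. by case: x => [[u|u] ?]. Qed.

End Exponents.

(* Main.v *)
Require Import Defs.
From HB Require Import structures.
From mathcomp Require Import all_boot all_order.
From mathcomp Require Import zify.
Set Implicit Arguments.
Unset Strict Implicit.
Unset Printing Implicit Defensive.
Import Order.TTheory.

(* Each level of the L-shaped region, ordered by the first coordinate, together
   with the next level forms a path, which breaks into a left and a right path
   from rank [b0 + a1 - 1] on, where the inner corner [(b0, a1)] is missing. An
   end of a path is blocked if one of the two covers of the end point is outside
   the region. A proper subset of a path can be pushed away from a missing point,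
   so its shadow is at least as large as the set (larger if no end is blocked),
   and a shadow gets smaller than the set only by filling a path blocked at both
   ends. Hence the optimal initial segments fill the left path first when the
   left end gets blocked first, and stay optimal exactly when the left path is
   also the shorter one once the right end is blocked. *)

(** * Initial segments of one level under a total order *)

Section Segments.

Variables (d : Order.disp_t) (R : rankedPosetType d) (tle : rel R).
Hypotheses (tle_total : total tle) (tle_anti : antisymmetric tle).
Hypothesis tle_trans : transitive tle.
Implicit Types (x y : R) (S : {set R}) (k q : nat).

Let above k x := [set y in level R k | (y != x) && tle x y].

Lemma in_Seg k q x : (x \in Seg tle k q) = (rk x == k) && (#|above k x| < q).
Proof. by rewrite !inE. Qed.

Lemma Seg_sub_level k q : Seg tle k q \subset level R k.
Proof. by apply/subsetP => x; rewrite in_Seg inE => /andP[]. Qed.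

Lemma Seg_mono k q q' : q <= q' -> Seg tle k q \subset Seg tle k q'.
Proof.
move=> qq'; apply/subsetP => x; rewrite !in_Seg => /andP[-> /=] lt.
exact: leq_trans lt qq'.
Qed.

Definition upset k S := forall x y, x \in S -> rk y = k -> tle x y -> y \in S.

(** For [x] in [S] all larger elements of its level lie in [S] minus [x]; for [x] of the level
    outside [S], totality puts all of [S] above [x]. Counting larger elements thus decides
    membership. *)
Lemma upset_Seg k S : S \subset level R k -> upset k S -> S = Seg tle k #|S|.
Proof.
move=> /subsetP Sk Su; apply/setP => x; rewrite in_Seg.
case: (boolP (x \in S)) => xS.
  have := Sk _ xS; rewrite inE => -> /=; apply/esym.
  rewrite (cardsD1 x S) xS add1n ltnS; apply: subset_leq_card.
  apply/subsetP => y; rewrite !inE => /andP[/eqP ky /andP[-> xy]] /=.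
  exact: Su xS ky xy.
apply/esym/negbTE; rewrite negb_and -leqNgt -implybE; apply/implyP => /eqP kx.
apply: subset_leq_card; apply/subsetP => y yS; have := Sk _ yS.
rewrite !inE => ->; rewrite /=; case: eqVneq => [eyx|nyx] /=.
  by rewrite -eyx yS in xS.
case/orP: (tle_total x y) => // yx.
by case/negP: xS; apply: Su yS kx yx.
Qed.

Lemma exists_upset k q : q <= #|level R k| ->
  exists2 S : {set R}, S \subset level R k & upset k S /\ #|S| = q.
Proof.
elim: q => [_|q IHq ltq].
  by exists set0; rewrite ?sub0set ?cards0 //; split=> // x y; rewrite inE.
have [S Sk [Su cS]] := IHq (ltnW ltq).
have /set0Pn[x0 x0C] : level R k :\: S != set0.
  by rewrite setD_eq0; apply: contraTN ltq => /subset_leq_card; rewrite cS -leqNgt.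
(* The element of the complement with the fewest larger elements is the largest one there. *)
have [x xC xmin] := arg_minnP (fun x => #|above k x|) x0C.
have : x \in level R k :\: S by []; rewrite !inE => /andP[xS kx].
exists (x |: S); last split; last by rewrite cardsU1 xS cS.
  by rewrite subUset Sk sub1set inE kx.
move=> y z; rewrite !in_setU1 => /orP[/eqP->|yS] kz yz; last first.
  by rewrite (Su _ _ yS kz yz) orbT.
case: eqVneq => //= nzx; apply: contraTT isT => zS.
have /xmin : z \in level R k :\: S by rewrite !inE zS kz eqxx.
rewrite leqNgt => /negP[]; apply: proper_card; apply/properP; split.
  apply/subsetP => t; rewrite !inE => /and3P[-> ntz zt] /=.
  rewrite (tle_trans yz zt) andbT; apply: contraNneq ntz => etx.
  by apply/eqP/tle_anti; rewrite zt etx yz.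
by exists z; rewrite !inE ?kz ?eqxx ?nzx.
Qed.

Lemma card_Seg k q : q <= #|level R k| -> #|Seg tle k q| = q.
Proof. by case/exists_upset => S Sk [Su cS]; rewrite -{1}cS -(upset_Seg Sk). Qed.

Lemma Seg_upset k q : upset k (Seg tle k q).
Proof.
move=> x y; rewrite !in_Seg => /andP[_ lt] -> xy; rewrite eqxx /=.
case: (eqVneq x y) => [<- //|nxy]; apply: leq_ltn_trans lt.
apply: subset_leq_card; apply/subsetP => t; rewrite !inE => /and3P[-> nty yt] /=.
rewrite (tle_trans xy yt) andbT; apply: contraNneq nxy => etx.
by apply/eqP/tle_anti; rewrite xy -etx yt.
Qed.

End Segments.

(** * Total orders induced by a numerical key *)

Section Keys.

Variables (d : Order.disp_t) (R : rankedPosetType d) (key : R -> nat).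

Definition downset (S : {set R}) :=
  forall x y, x \in S -> rk y = rk x -> key y <= key x -> y \in S.

(** Smaller keys count as larger elements, so segments are downsets within a level; condition (ii)
    becomes the preservation of downsets by the shadow. *)
Lemma macaulay_key :
    (forall x y, rk x = rk y -> key x = key y -> x = y) ->
    (forall k (S : {set R}), S \subset level R k -> downset S ->
       downset (upper_shadow S)) ->
    (forall k (S A : {set R}), S \subset level R k -> A \subset level R k -> downset S ->
       #|A| = #|S| -> #|upper_shadow S| <= #|upper_shadow A|) ->
  macaulay R.
Proof.
move=> key_inj shD shO.
(* Keys may coincide on different levels; comparing ranks then makes the order antisymmetric. *)
pose tle : rel R := fun x y =>
  (key y < key x) || (key y == key x) && (rk y <= rk x).
have tleT : total tle by move=> x y; rewrite /tle; lia.
have tleA : antisymmetric tle.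
  by move=> x y; rewrite /tle => xy; apply: key_inj; lia.
have tleTr : transitive tle by move=> y x z; rewrite /tle; lia.
exists tle; split=> // k A Ak.
have cS := card_Seg tleT tleA tleTr (subset_leq_card Ak).
have Sk := Seg_sub_level tle k #|A|.
have Sd : downset (Seg tle k #|A|).
  move=> x y xS kyx kk; have := subsetP Sk _ xS; rewrite inE => /eqP kx.
  apply: (Seg_upset tleA tleTr xS); first by rewrite kyx.
  by rewrite /tle kyx; lia.
split; first by apply: (shO k).
apply: (upset_Seg tleT).
  apply/subsetP => y; rewrite !inE => /existsP[x /andP[xS /rk_covers->]].
  by have := subsetP Sk _ xS; rewrite inE eqSS.
move=> x y xS ky xy; apply: (shD _ _ Sk Sd x) => //.
  move: xS; rewrite !inE => /existsP[z /andP[zS /rk_covers->]].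
  by have := subsetP Sk _ zS; rewrite inE ky => /eqP->.
by move: xy; rewrite /tle; lia.
Qed.

End Keys.

(** * Plane coordinates, covers as unit steps, and counting by first coordinates *)

Section Charts.

Variables (d : Order.disp_t) (T : rankedPosetType d).

(* [X] and [Y] are coordinates identifying [T] with the region [D] of the plane. *)
Definition chart (D : nat -> nat -> bool) (X Y : T -> nat) : Prop :=
  [/\ forall x y, (x <= y)%O = (X x <= X y) && (Y x <= Y y),
      forall x, rk x = X x + Y x,
      forall x, D (X x) (Y x) &
      forall i j, D i j -> exists x, X x = i /\ Y x = j].

Lemma chart_swap D X Y : chart D X Y -> chart (fun i j => D j i) Y X.
Proof.
case=> leXY rkXY inD exD; split=> // [x y|x|i j /exD [x []]].
- by rewrite leXY andbC.
- by rewrite rkXY addnC.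
- by exists x.
Qed.

Lemma chart_ext D D' X Y :
  (forall i j, D i j = D' i j) -> chart D X Y -> chart D' X Y.
Proof.
by move=> eqD [leXY rkXY inD exD]; split=> // [x|i j]; rewrite -eqD //; apply: exD.
Qed.

Variables (D : nat -> nat -> bool) (X Y : T -> nat).
Hypothesis chXY : chart D X Y.
Implicit Types (A B : {set T}) (x y : T).

Lemma chart_inj x y : X x = X y -> Y x = Y y -> x = y.
Proof.
case: chXY => leXY _ _ _ ex ey.
by apply: le_anti; rewrite !leXY ex ey !leqnn.
Qed.

Definition step x y :=
  (X y = X x /\ Y y = (Y x).+1) \/ (X y = (X x).+1 /\ Y y = Y x).

Lemma chart_covers x y : covers y x <-> step x y.
Proof.
case: chXY => leXY rkXY _ _; rewrite /step; split.
  move=> yx; have := rk_covers _ _ yx; move/andP: yx => [/ltW + _].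
  by rewrite leXY !rkXY; lia.
move=> xy; rewrite /covers lt_neqAle leXY; apply/andP; split.
  apply/andP; split; last by lia.
  by apply: contraTneq isT => exy; subst y; lia.
apply/existsP => -[z]; rewrite !lt_neqAle !leXY.
case/andP=> /andP[/eqP nxz xz] /andP[/eqP nzy zy].
have [ezx|ezy] : (X x = X z /\ Y x = Y z) \/ (X z = X y /\ Y z = Y y) by lia.
  by apply: nxz; apply: chart_inj; lia.
by apply: nzy; apply: chart_inj; lia.
Qed.

Lemma shadowP A y : reflect
  (exists2 x, x \in A & step x y)
  (y \in upper_shadow A).
Proof.
rewrite inE; apply: (iffP existsP) => [[x /andP[xA /chart_covers]]|[x xA xy]].
  by exists x.
by exists x; rewrite xA; apply/chart_covers.
Qed.

Lemma in_level k x : x \in level T k -> X x + Y x = k.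
Proof. by case: chXY => _ rkXY _ _; rewrite inE rkXY => /eqP. Qed.

Lemma level_in k x : X x + Y x = k -> x \in level T k.
Proof. by case: chXY => _ rkXY _ _ <-; rewrite inE rkXY. Qed.

Lemma shadow_sub_level k A : A \subset level T k -> upper_shadow A \subset level T k.+1.
Proof.
move=> /subsetP Ak; apply/subsetP => y /shadowP[x /Ak /in_level xk xy].
by apply: level_in; move: xy; rewrite /step; lia.
Qed.

Lemma shadowS A B : A \subset B -> #|upper_shadow A| <= #|upper_shadow B|.
Proof.
move=> /subsetP AB; apply: subset_leq_card; apply/subsetP => y /shadowP[x xA xy].
by apply/shadowP; exists x => //; apply: AB.
Qed.

(** The injection is described only by the first coordinates [u x] of its images, so no image point
    has to be chosen. *)
Lemma leq_card_coord A B (u : T -> nat) :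
    {in A, forall x, exists2 y, y \in B & X y = u x} -> {in A &, injective u} ->
  #|A| <= #|B|.
Proof.
move=> uB uI; rewrite !cardE -(size_map u) -(size_map X); apply: uniq_leq_size.
  rewrite map_inj_in_uniq ?enum_uniq // => x y; rewrite !mem_enum.
  exact: uI.
move=> i /mapP[x]; rewrite mem_enum => /uB[y yB <-] ->.
by apply: map_f; rewrite mem_enum.
Qed.

(** At most one point of [A] satisfies [P]; it gets no image and accounts for the extra one. *)
Lemma leq_card_coord1 A B (u : T -> nat) (P : pred T) :
    {in A &, forall x x', P x -> P x' -> x = x'} ->
    {in A, forall x, ~~ P x -> exists2 y, y \in B & X y = u x} ->
    {in A &, forall x x', ~~ P x -> ~~ P x' -> u x = u x' -> x = x'} ->
  #|A| <= #|B|.+1.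
Proof.
move=> P1 uB uI; rewrite -(cardsID [set x | P x] A) -add1n; apply: leq_add.
  apply/card_le1_eqP => x x'; rewrite !inE => /andP[xA Px] /andP[x'A Px'].
  exact: P1.
apply: (@leq_card_coord _ _ u) => [x|x x']; rewrite !inE.
  by case/andP=> nPx xA; apply: uB.
by move=> /andP[nPx xA] /andP[nPx' x'A]; apply: uI.
Qed.

(* Moving right the points selected by [dir] and up the other ones is injective
   unless a point moving right is followed by one moving up. *)
Lemma leq_card_push k A (dir : pred nat) :
    A \subset level T k ->
    {in A, forall x, dir (X x) -> D (X x).+1 (Y x)} ->
    {in A, forall x, ~~ dir (X x) -> D (X x) (Y x).+1} ->
    {in A &, forall x x', X x' = (X x).+1 -> dir (X x) -> dir (X x')} ->
  #|A| <= #|upper_shadow A|.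
Proof.
case: chXY => _ _ _ exD /subsetP Ak rightD upD dirA.
(* The boolean [dir (X x)] counts as 0 or 1: this is the first coordinate after the move. *)
apply: (@leq_card_coord _ _ (fun x => X x + dir (X x))) => [x xA|x x' xA x'A].
  case: (boolP (dir (X x))) => dx.
    have [y [Xy Yy]] := exD _ _ (rightD x xA dx).
    by exists y; [apply/shadowP; exists x => //; right | lia].
  have [y [Xy Yy]] := exD _ _ (upD x xA dx).
  by exists y; [apply/shadowP; exists x => //; left | lia].
have := in_level (Ak _ xA); have := in_level (Ak _ x'A).
have := dirA _ _ xA x'A; have := dirA _ _ x'A xA.
move=> h1 h2 kx' kx eu; suff: X x = X x' by move=> eX; apply: chart_inj; lia.
by move: h1 h2 eu; case: (dir (X x)); case: (dir (X x')); lia.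
Qed.

End Charts.

(** * Shadows in an L-shaped region: the wide rectangle [a0] by [a1] and the tall one [b0] by
    [b1] *)

Definition corner a0 a1 b0 b1 i j := (i < a0) && (j < a1) || (i < b0) && (j < b1).

Section Corner.

Variables (d : Order.disp_t) (T : rankedPosetType d) (X Y : T -> nat).
Variables (a0 a1 b0 b1 : nat).
Hypotheses (b0a0 : b0 <= a0) (a1b1 : a1 <= b1).
Hypothesis chXY : chart (corner a0 a1 b0 b1) X Y.
Implicit Types (A S : {set T}) (k : nat) (x y h : T).

Lemma in_corner x : corner a0 a1 b0 b1 (X x) (Y x).
Proof. by case: chXY. Qed.

Lemma corner_ex i j :
  corner a0 a1 b0 b1 i j -> exists x, X x = i /\ Y x = j.
Proof. by case: chXY => _ _ _; apply. Qed.

(** From rank [b0 + a1 - 1] on, these are the two components of the level; at lower ranks the cut at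
    column [b0] has no such meaning. *)
Definition lft k := [set x in level T k | X x < b0].
Definition rgt k := [set x in level T k | b0 <= X x].

Lemma in_lft k x : (x \in lft k) = (x \in level T k) && (X x < b0).
Proof. by rewrite inE. Qed.

Lemma in_rgt k x : (x \in rgt k) = (x \in level T k) && (b0 <= X x).
Proof. by rewrite inE. Qed.

Lemma lft_sub_level k : lft k \subset level T k.
Proof. by apply/subsetP => x; rewrite in_lft => /andP[]. Qed.

Lemma rgt_sub_level k : rgt k \subset level T k.
Proof. by apply/subsetP => x; rewrite in_rgt => /andP[]. Qed.

(** Every point takes the cover facing the gap [h]: right if it lies left of [h], up otherwise. This
    cover is in the region because the corner [(b0, a1)] has rank above [k.+1], and the gap keeps
    the moves from colliding. *)
Lemma leq_shadow_path k A h :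
    k.+1 < b0 + a1 -> A \subset level T k -> h \in level T k -> h \notin A ->
  #|A| <= #|upper_shadow A|.
Proof.
move=> ks Ak /(in_level chXY) kh hA.
apply: (leq_card_push chXY (k := k) (dir := fun i => i < X h)) => // x.
- move=> /(subsetP Ak) /(in_level chXY) kx; move: (in_corner x) (in_corner h).
  by rewrite /corner; lia.
- move=> xA; have /(in_level chXY) kx := subsetP Ak _ xA.
  rewrite -leqNgt leq_eqVlt => /predU1P[hx|].
    by case/negP: hA; rewrite (_ : h = x) //; apply: (chart_inj chXY); lia.
  by move: (in_corner x) (in_corner h); rewrite /corner; lia.
- move=> x' xA x'A; have /(in_level chXY) kx' := subsetP Ak _ x'A.
  move=> ex' xh; rewrite ltn_neqAle; apply/andP; split; last by lia.
  apply/eqP => eh; case/negP: hA.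
  by rewrite (_ : h = x') //; apply: (chart_inj chXY); lia.
Qed.

(* From rank [b0 + a1 - 1] on, the inner corner [(b0, a1)] disconnects the level. *)
Lemma leq_shadow_split k A :
    b0 + a1 <= k.+1 -> A \subset level T k ->
    [\/ k.+1 < b1, b0 + b1 <= k.+1 | ~~ (lft k \subset A)] ->
    [\/ k.+1 < a0, a0 + a1 <= k.+1 | ~~ (rgt k \subset A)] ->
  #|A| <= #|upper_shadow A|.
Proof.
move=> ks Ak HL HR.
(* Left points move right up to column [hL]: the missing point, or 0 if the left end is free or the
   component empty. The bound on [hL] keeps them inside the component. *)
have [hL hLb HhL] : exists2 hL, hL <= b0.-1 & forall x, x \in A -> X x < b0 ->
    [/\ X x < hL -> corner a0 a1 b0 b1 (X x).+1 (Y x),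
        hL <= X x -> corner a0 a1 b0 b1 (X x) (Y x).+1 & X x <> hL \/ hL = 0].
  case: HL => [kb|kb|/subsetPn[h]].
  - exists 0 => // x /(subsetP Ak) /(in_level chXY) kx xb.
    by split; move: (in_corner x); rewrite /corner; lia.
  - exists 0 => // x /(subsetP Ak) /(in_level chXY) kx xb.
    by split; move: (in_corner x); rewrite /corner; lia.
  rewrite in_lft => /andP[/(in_level chXY) kh hb] hA.
  exists (X h) => [|x xA xb]; first by lia.
  have kx := in_level chXY (subsetP Ak _ xA).
  have nxh : X x <> X h.
    by move=> eX; case/negP: hA; rewrite (_ : h = x) //; apply: (chart_inj chXY); lia.
  by split; move: (in_corner x) (in_corner h); rewrite /corner; lia.
(* Likewise on the right, where the default [a0] lets all points move right. *)
have [hR HhR] : exists hR, forall x, x \in A -> b0 <= X x ->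
    [/\ X x < hR -> corner a0 a1 b0 b1 (X x).+1 (Y x),
        hR <= X x -> corner a0 a1 b0 b1 (X x) (Y x).+1 & X x <> hR].
  case: HR => [ka|ka|/subsetPn[h]].
  - exists a0 => x /(subsetP Ak) /(in_level chXY) kx xb.
    by split; move: (in_corner x); rewrite /corner; lia.
  - exists a0 => x /(subsetP Ak) /(in_level chXY) kx xb.
    by split; move: (in_corner x); rewrite /corner; lia.
  rewrite in_rgt => /andP[/(in_level chXY) kh hb] hA.
  exists (X h) => x xA xb.
  have kx := in_level chXY (subsetP Ak _ xA).
  have nxh : X x <> X h.
    by move=> eX; case/negP: hA; rewrite (_ : h = x) //; apply: (chart_inj chXY); lia.
  by split; move: (in_corner x) (in_corner h); rewrite /corner; lia.
apply: (leq_card_push chXY (k := k)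
          (dir := fun i => if i < b0 then i < hL else i < hR)) => // x.
- move=> xA; case: (ltnP (X x) b0) => xb.
    by have [] := HhL _ xA xb.
  by have [] := HhR _ xA xb.
- move=> xA; case: (ltnP (X x) b0) => xb; rewrite -leqNgt.
    by have [] := HhL _ xA xb.
  by have [] := HhR _ xA xb.
- move=> x' xA x'A ex'; case: (ltnP (X x) b0) => [xb xhL|xb xhR].
    have xb' : X x' < b0 by lia.
    by have [_ _] := HhL x' x'A xb'; rewrite xb'; lia.
  have xb' : b0 <= X x' by lia.
  by have [_ _] := HhR x' x'A xb'; rewrite ltnNge xb' /=; lia.
Qed.

(** All upper covers exist, and the right cover of the rightmost point is one more. *)
Lemma ltn_shadow k A :
    k.+1 < b0 + a1 -> k.+1 < b1 -> k.+1 < a0 -> A \subset level T k ->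
  A != set0 -> #|A| < #|upper_shadow A|.
Proof.
move=> ks kb ka Ak /set0Pn[x0 x0A].
have [m mA mmax] := arg_maxnP (P := mem A) X x0A.
have km := in_level chXY (subsetP Ak _ mA).
have [y0 [Xy0 Yy0]] : exists y0, X y0 = (X m).+1 /\ Y y0 = Y m.
  by apply: corner_ex; move: (in_corner m); rewrite /corner; lia.
rewrite (cardsD1 y0 (upper_shadow A)) (_ : y0 \in upper_shadow A); last first.
  by apply/(shadowP chXY); exists m => //; right.
rewrite add1n ltnS; apply: (leq_card_coord (X := X) (u := X)) => [x xA|x x' xA x'A].
  have kx := in_level chXY (subsetP Ak _ xA); have := mmax _ xA.
  have [y [Xy Yy]] : exists y, X y = X x /\ Y y = (Y x).+1.
    by apply: corner_ex; move: (in_corner x); rewrite /corner; lia.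
  exists y => //; rewrite in_setD1; apply/andP; split.
    by apply: contraTneq isT => ey; subst y; lia.
  by apply/(shadowP chXY); exists x => //; left.
have kx := in_level chXY (subsetP Ak _ xA).
have kx' := in_level chXY (subsetP Ak _ x'A).
by move=> eX; apply: (chart_inj chXY); lia.
Qed.

Lemma lft_ex k :
  0 < b0 -> b0 + a1 <= k.+1 -> k.+1 < b0 + b1 -> exists x, x \in lft k.
Proof.
move=> b0p ks kb; have [|x [Xx Yx]] := @corner_ex b0.-1 (k.+1 - b0).
  by rewrite /corner; lia.
by exists x; rewrite in_lft (level_in chXY) ?Xx //; lia.
Qed.

Lemma rgt_ex k :
  a0 <= k.+1 -> b0 + a1 <= k.+1 -> k.+1 < a0 + a1 -> exists x, x \in rgt k.
Proof.
move=> ak ks ka; have [|x [Xx Yx]] := @corner_ex a0.-1 (k.+1 - a0).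
  by rewrite /corner; lia.
by exists x; rewrite in_rgt (level_in chXY) ?Xx //; lia.
Qed.

(** The shift by [b1 - a1] along the level takes the top row of the left component to row [a1 - 1];
    [b0 + b1 <= a0 + a1] keeps the image left of column [a0]. *)
Lemma leq_card_lft_rgt k :
    b0 + a1 <= k.+1 -> a0 <= k.+1 -> b0 + b1 <= a0 + a1 ->
  #|lft k| <= #|rgt k|.
Proof.
move=> ks ka ba; apply: (leq_card_coord (X := X) (u := fun x => X x + (b1 - a1))).
  move=> x; rewrite in_lft => /andP[/(in_level chXY) kx xb].
  have [y [Xy Yy]] : exists y, X y = X x + (b1 - a1) /\ Y y = Y x - (b1 - a1).
    by apply: corner_ex; move: (in_corner x); rewrite /corner; lia.
  exists y => //; move: (in_corner x); rewrite /corner => cx.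
  by rewrite in_rgt (level_in chXY); lia.
move=> x x'; rewrite !in_lft => /andP[/(in_level chXY) kx _].
by move=> /andP[/(in_level chXY) kx' _] eX; apply: (chart_inj chXY); lia.
Qed.

(** The bounds on [S] meet the lower bounds for [A] rank by rank. In the split range with the left
    end blocked, if [S] is a proper part of [lft k], then [A] is too small to contain [lft k] or,
    when the right end is blocked, the at least as large [rgt k]. If [S] contains [lft k], it saves
    one point, and [A], missing some [h], cannot save on both components. *)
Lemma leq_shadow_optimal k S A :
    b1 <= a0 -> b0 + b1 <= a0 + a1 ->
    S \subset level T k -> A \subset level T k -> #|A| = #|S| ->
    #|upper_shadow S| <= #|S|.+1 ->
    (b1 <= k.+1 \/ b0 + a1 <= k.+1 -> #|upper_shadow S| <= #|S|) ->
    (b0 + a1 <= k.+1 -> b1 <= k.+1 < b0 + b1 -> lft k \subset S ->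
      #|upper_shadow S| < #|S|) ->
    (b0 + a1 <= k.+1 -> S \subset lft k \/ lft k \subset S) ->
  #|upper_shadow S| <= #|upper_shadow A|.
Proof.
move=> ba bbaa Sk Ak cAS F1 F2 F3 F4.
have [AL|AnL] := boolP (level T k \subset A).
  have /eqP eA : A == level T k by rewrite eqEsubset Ak AL.
  suff -> : S = A by [].
  by apply/eqP; rewrite eqEcard cAS leqnn andbT eA.
have [A0|An0] := eqVneq A set0.
  have /cards0_eq-> : #|S| = 0 by rewrite -cAS A0 cards0.
  rewrite (_ : upper_shadow set0 = set0) ?cards0 //.
  by apply/setP => y; rewrite !inE; apply/negbTE/existsP => -[x]; rewrite inE.
have /subsetPn[h kh hA] := AnL.
have [ks|ks] := ltnP k.+1 (b0 + a1).
  have [kb|kb] := ltnP k.+1 b1.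
    by apply: leq_trans F1 _; rewrite -cAS; apply: (@ltn_shadow k) => //; lia.
  apply: leq_trans (F2 (or_introl kb)) _; rewrite -cAS.
  exact: leq_shadow_path kh hA.
have F2' := F2 (or_intror ks).
have [kb|kb] := ltnP k.+1 b1.
  apply: leq_trans F2' _; rewrite -cAS.
  by apply: (leq_shadow_split ks Ak); [apply: Or31 | apply: Or31; lia].
have [kbb|kbb] := leqP (b0 + b1) k.+1.
  apply: leq_trans F2' _; rewrite -cAS; apply: (leq_shadow_split ks Ak).
    exact: Or32.
  apply: Or33; apply/subsetPn; exists h => //; rewrite in_rgt kh /=.
  by have := in_level chXY kh; move: (in_corner h); rewrite /corner; lia.
have [LS|nLS] := boolP (lft k \subset S); last first.
  have {F4} SL : S \subset lft k by case: (F4 ks) nLS => // ->.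
  have ltL : #|A| < #|lft k|.
    by rewrite cAS; apply: proper_card; rewrite properE SL.
  apply: leq_trans F2' _; rewrite -cAS; apply: (leq_shadow_split ks Ak).
    by apply: Or33; apply: contraL ltL => /subset_leq_card; rewrite -leqNgt.
  have [ka|ka] := ltnP k.+1 a0; first exact: Or31.
  apply: Or33; apply: contraL (leq_trans ltL (leq_card_lft_rgt ks ka bbaa)).
  by move=> /subset_leq_card; rewrite -leqNgt.
have {F3} lt : #|upper_shadow S| < #|A|.
  by rewrite cAS; apply: F3 => //; rewrite kb kbb.
(* If [A] without [x] fills no component blocked at both ends, the shadow of [A] has at least [#|A|]
   minus one points, which [S] does not exceed. *)
suff [x Lx Rx] : exists2 x, ~~ (lft k \subset A :\ x) &
    [\/ k.+1 < a0, a0 + a1 <= k.+1 | ~~ (rgt k \subset A :\ x)].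
  have := shadowS chXY (subsetDl A [set x]).
  have := leq_shadow_split ks (subset_trans (subsetDl A [set x]) Ak) (Or33 _ _ Lx) Rx.
  by move: lt; rewrite (cardsD1 x A); case: (x \in A); lia.
have missL x y : x \in lft k -> x \notin A :\ y -> ~~ (lft k \subset A :\ y).
  by move=> xl xA; apply/subsetPn; exists x.
have missR x y : x \in rgt k -> x \notin A :\ y -> ~~ (rgt k \subset A :\ y).
  by move=> xl xA; apply/subsetPn; exists x.
have [hb|hb] := ltnP (X h) b0.
  have Lh y : ~~ (lft k \subset A :\ y).
    by apply: (missL h); rewrite ?in_lft ?kh // !inE negb_and hA orbT.
  have [ka|ka] := ltnP k.+1 a0; first by exists h => //; apply: Or31.
  have [kaa|kaa] := leqP (a0 + a1) k.+1; first by exists h => //; apply: Or32.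
  have [x xR] := rgt_ex ka ks kaa; exists x => //; apply: Or33.
  by apply: (missR x) => //; rewrite !inE eqxx.
have [|x xL] := lft_ex _ ks kbb; first by lia.
exists x; first by apply: (missL x) => //; rewrite !inE eqxx.
by apply/Or33/(missR h); rewrite ?in_rgt ?kh // !inE negb_and hA orbT.
Qed.

(* The order is given by [key], smaller keys being larger. The last hypotheses
   bound the upper shadow of an initial segment [S] from above; together with
   the lower bounds on arbitrary shadows they make [S] optimal. *)
Lemma macaulay_corner (key : T -> nat) :
    b1 <= a0 -> b0 + b1 <= a0 + a1 ->
    (forall x y, rk x = rk y -> key x = key y -> x = y) ->
    (forall x y y', step X Y x y -> rk y' = rk y -> key y' < key y ->
       exists x', step X Y x' y' /\ key x' <= key x) ->
    (forall k x x', b0 + a1 <= k.+1 -> x \in lft k -> x' \in rgt k ->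
       key x <= key x') ->
    (forall k S, S \subset level T k -> downset key S ->
      [/\ #|upper_shadow S| <= #|S|.+1,
          b1 <= k.+1 \/ b0 + a1 <= k.+1 -> #|upper_shadow S| <= #|S| &
          b0 + a1 <= k.+1 -> b1 <= k.+1 < b0 + b1 -> lft k \subset S ->
            #|upper_shadow S| < #|S|]) ->
  macaulay T.
Proof.
move=> ba bbaa keyI keyS keyLR keyF; apply: (macaulay_key (key := key)) => //.
  move=> k S Sk Sd y y' /(shadowP chXY)[x xS xy] ry; rewrite leq_eqVlt.
  case/predU1P=> [/(keyI _ _ ry)->|lt]; first by apply/(shadowP chXY); exists x.
  have [x' [x'y' kx']] := keyS _ _ _ xy ry lt.
  apply/(shadowP chXY); exists x' => //; apply: Sd kx' => //.
  by move: ry xy x'y'; case: chXY => _ rkXY _ _; rewrite /step !rkXY; lia.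
move=> k S A Sk Ak Sd cA; have [F1 F2 F3] := keyF _ _ Sk Sd.
apply: (leq_shadow_optimal ba bbaa Sk Ak cA F1 F2 F3) => ks.
have [SL|/subsetPn[x xS xL]] := boolP (S \subset lft k); [by left | right].
have kx := subsetP Sk _ xS; apply/subsetP => z zL.
have kz := subsetP (lft_sub_level k) _ zL.
apply: Sd xS _ _; first by move: kx kz; rewrite !inE => /eqP-> /eqP->.
apply: keyLR zL _ => //; rewrite in_rgt kx.
by move: xL; rewrite in_lft kx /= -leqNgt.
Qed.

(** * Sufficiency: two explicit orders *)

Lemma macaulay_corner_asc :
  b1 <= a0 -> b0 + b1 <= a0 + a1 -> b1 <= b0 + a1 -> macaulay T.
Proof.
have [_ rkXY _ _] := chXY.
(* Filling starts at the left end, which is blocked no later than the corner appears since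
   [b1 <= b0 + a1]. *)
move=> ba bbaa bs; apply: (macaulay_corner (key := X)) => //.
- by move=> x y; rewrite !rkXY => exy eX; apply: (chart_inj chXY); lia.
- move=> x y y' xy; rewrite !rkXY => ry lt.
  case: (posnP (X y')) => X0.
    have [x' [Xx' Yx']] : exists x', X x' = X y' /\ Y x' = (Y y').-1.
      by apply: corner_ex; move: (in_corner y'); rewrite /corner; lia.
    by exists x'; move: xy; rewrite /step; lia.
  have [x' [Xx' Yx']] : exists x', X x' = (X y').-1 /\ Y x' = Y y'.
    by apply: corner_ex; move: (in_corner y'); rewrite /corner; lia.
  by exists x'; move: xy; rewrite /step; lia.
- move=> k x x' ks; rewrite in_lft in_rgt => /andP[_ xb] /andP[_].
  exact/leq_trans/ltnW.
move=> k S Sk Sd.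
have kS y : y \in upper_shadow S -> X y + Y y = k.+1.
  by move=> /(subsetP (shadow_sub_level chXY Sk)); apply: in_level chXY _ _.
have pull y : y \in upper_shadow S -> X y <> 0 ->
    exists z, [/\ z \in S, X z = (X y).-1 & Y z = Y y].
  move=> /(shadowP chXY)[x xS xy] X0.
  have [z [Xz Yz]] : exists z, X z = (X y).-1 /\ Y z = Y y.
    by apply: corner_ex; move: (in_corner y); rewrite /corner; lia.
  exists z; split=> //; apply: Sd xS _ _; move: xy; rewrite /step ?rkXY; lia.
split.
(* Only a shadow point in column 0 has no left neighbour to be paired with. *)
- apply: (leq_card_coord1 (X := X) (u := fun x => (X x).-1) (P := fun x => X x == 0)).
  + move=> y y' /kS ky /kS ky' X0 X0'; apply: (chart_inj chXY); lia.
  + by move=> y yS /eqP X0; have [z [zS Xz _]] := pull y yS X0; exists z.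
  + move=> y y' /kS ky /kS ky' X0 X0' eX; apply: (chart_inj chXY); lia.
- move=> kb; have X0 y : y \in upper_shadow S -> X y <> 0.
    by move=> /kS ky; move: (in_corner y); rewrite /corner; lia.
  apply: (leq_card_coord (X := X) (u := fun x => (X x).-1)) => [y yS|y y' yS y'S eX].
    by have [z [zS Xz _]] := pull y yS (X0 y yS); exists z.
  have := X0 y yS; have := X0 y' y'S; have := kS y yS; have := kS y' y'S.
  by move=> *; apply: (chart_inj chXY); lia.
(* The last point [z0] of the left component stays unpaired: its right cover would be in column
   [b0], at or above row [a1]. *)
move=> ks kb LS; have [|z0 [Xz0 Yz0]] := @corner_ex b0.-1 (k.+1 - b0).
  by rewrite /corner; lia.
have z0S : z0 \in S.
  by apply: (subsetP LS); rewrite in_lft (level_in chXY) ?Xz0 //; lia.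
rewrite (cardsD1 z0 S) z0S add1n ltnS.
have X0 y : y \in upper_shadow S -> X y <> 0.
  by move=> /kS ky; move: (in_corner y); rewrite /corner; lia.
apply: (leq_card_coord (X := X) (u := fun x => (X x).-1)) => [y yS|y y' yS y'S eX].
  have [z [zS Xz Yz]] := pull y yS (X0 y yS); exists z => //.
  rewrite !inE zS andbT; apply/eqP => ez; subst z.
  by have := X0 y yS; have := kS y yS; move: (in_corner y); rewrite /corner; lia.
have := X0 y yS; have := X0 y' y'S; have := kS y yS; have := kS y' y'S.
by move=> *; apply: (chart_inj chXY); lia.
Qed.

(* Here the corner [(b0, a1)] appears before the left end is blocked, so the points
   above row [a1] have to be taken starting from the corner. *)
Lemma macaulay_corner_desc :
  b1 <= a0 -> b0 + b1 <= a0 + a1 -> b0 + a1 <= b1 -> macaulay T.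
Proof.
have [_ rkXY _ _] := chXY.
(* Points at or above row [a1] lie left of column [b0], so their keys are below [b0]: they come
   first, from right to left, and the others follow from left to right. *)
pose key x := if a1 <= Y x then b0 - (X x).+1 else b0 + X x.
move=> ba bbaa bs; apply: (macaulay_corner (key := key)) => //.
- move=> x y; rewrite !rkXY => exy ek; apply: (chart_inj chXY).
    by move: ek (in_corner x) (in_corner y); rewrite /key /corner; do ?case: ifP; lia.
  by move: ek (in_corner x) (in_corner y); rewrite /key /corner; do ?case: ifP; lia.
- move=> x y y' xy; rewrite !rkXY => ry lt.
  case: (posnP (X y')) => X0.
    have [x' [Xx' Yx']] : exists x', X x' = X y' /\ Y x' = (Y y').-1.
      by apply: corner_ex; move: (in_corner y'); rewrite /corner; lia.
    exists x'; move: xy (in_corner x) (in_corner y) (in_corner y') lt.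
    by rewrite /step /key /corner; do ?case: ifP; lia.
  have [x' [Xx' Yx']] : exists x', X x' = (X y').-1 /\ Y x' = Y y'.
    by apply: corner_ex; move: (in_corner y'); rewrite /corner; lia.
  exists x'; move: xy (in_corner x) (in_corner y) (in_corner y') lt.
  by rewrite /step /key /corner; do ?case: ifP; lia.
- move=> k x x' ks; rewrite in_lft in_rgt.
  case/andP=> [/(in_level chXY) kx xb] /andP[/(in_level chXY) kx' xb'].
  by move: (in_corner x) (in_corner x'); rewrite /key /corner; do ?case: ifP; lia.
move=> k S Sk Sd.
have kS y : y \in upper_shadow S -> X y + Y y = k.+1.
  by move=> /(subsetP (shadow_sub_level chXY Sk)); apply: in_level chXY _ _.
(* Shadow points above row [a1] are pulled down and those below it pulled left. Pulling down from
   row [a1] would collide with pulling left from the row beneath, and column 0 has no left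
   neighbour; at most one of these exceptions occurs per level. *)
pose P y := (Y y == a1) || (X y == 0) && (Y y < a1).
pose u y := if a1 <= Y y then X y else (X y).-1.
have pull y : y \in upper_shadow S -> ~~ P y ->
    exists z, [/\ z \in S, X z = u y & Y z = if a1 <= Y y then (Y y).-1 else Y y].
  move=> /(shadowP chXY)[x xS xy] nP.
  have [z [Xz Yz]] : exists z,
      X z = u y /\ Y z = if a1 <= Y y then (Y y).-1 else Y y.
    apply: corner_ex; move: (in_corner y) nP.
    by rewrite /corner /u /P; do ?case: ifP; lia.
  exists z; split=> //; apply: Sd xS _ _.
    by move: xy nP; rewrite /step !rkXY Xz Yz /u /P; do ?case: ifP; lia.
  move: xy nP (in_corner x) (in_corner y) (in_corner z).
  by rewrite /step /key Xz Yz /u /P /corner; do ?case: ifP; lia.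
have uI : {in upper_shadow S &, forall y y', ~~ P y -> ~~ P y' -> u y = u y' -> y = y'}.
  move=> y y' /kS ky /kS ky' nP nP' eu; suff eX : X y = X y'.
    by apply: (chart_inj chXY); lia.
  by move: eu nP nP'; rewrite /u /P; do ?case: ifP; lia.
split.
- apply: (leq_card_coord1 (X := X) (u := u) (P := P)) => //.
  + move=> y y' /kS ky /kS ky' p p'; apply: (chart_inj chXY);
      by move: p p'; rewrite /P; lia.
  + by move=> y yS nP; have [z [zS Xz _]] := pull y yS nP; exists z.
- move=> kb; have nP y : y \in upper_shadow S -> ~~ P y.
    by move=> /kS ky; move: (in_corner y); rewrite /corner /P; lia.
  apply: (leq_card_coord (X := X) (u := u)) => [y yS|y y' yS y'S].
    by have [z [zS Xz _]] := pull y yS (nP y yS); exists z.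
  exact: uI (nP y yS) (nP y' y'S).
(* In this order the left component ends at its top-row point, which is unpaired because its upper
   cover is outside. *)
move=> ks kb LS; have [|z0 [Xz0 Yz0]] := @corner_ex (k.+1 - b1) b1.-1.
  by rewrite /corner; lia.
have z0S : z0 \in S.
  by apply: (subsetP LS); rewrite in_lft (level_in chXY) ?Xz0 //; lia.
rewrite (cardsD1 z0 S) z0S add1n ltnS.
have nP y : y \in upper_shadow S -> ~~ P y.
  by move=> /kS ky; move: (in_corner y); rewrite /corner /P; lia.
apply: (leq_card_coord (X := X) (u := u)) => [y yS|y y' yS y'S].
  have [z [zS Xz Yz]] := pull y yS (nP y yS); exists z => //.
  rewrite !inE zS andbT; apply/eqP => ez; subst z.
  have := nP y yS; have := kS y yS; move: Yz (in_corner y).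
  by rewrite /corner /P; case: ifP; lia.
exact: uI (nP y yS) (nP y' y'S).
Qed.

Lemma macaulay_corner_suff :
  b1 <= a0 -> b0 + b1 <= a0 + a1 -> macaulay T.
Proof.
move=> ba bbaa; case/orP: (leq_total b1 (b0 + a1)).
  exact: macaulay_corner_asc.
exact: macaulay_corner_desc.
Qed.

(** * Necessity: the forced segments contradict each other *)

Lemma ltn_card_rgt_lft k :
    b0 + a1 <= k.+1 -> b1 <= a0 <= k.+1 -> k.+1 < b0 + b1 -> a0 + a1 < b0 + b1 ->
  #|rgt k| < #|lft k|.
Proof.
move=> ks ka kb ba; have [|z [Xz Yz]] := @corner_ex b0.-1 (k.+1 - b0).
  by rewrite /corner; lia.
rewrite (cardsD1 z (lft k)) in_lft (level_in chXY) ?Xz; last by lia.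
rewrite (_ : b0.-1 < b0) ?add1n ?ltnS; last by lia.
(* The shift along the level now goes left; the strict inequality of the sums keeps its image left
   of column [b0 - 1], so [z] is missed. *)
apply: (leq_card_coord (X := X) (u := fun x => X x - (b1 - a1))).
  move=> x; rewrite in_rgt => /andP[/(in_level chXY) kx xb].
  have [y [Xy Yy]] : exists y, X y = X x - (b1 - a1) /\ Y y = Y x + (b1 - a1).
    by apply: corner_ex; move: (in_corner x); rewrite /corner; lia.
  exists y => //; move: (in_corner x); rewrite /corner => cx.
  rewrite in_setD1 in_lft (level_in chXY); last by lia.
  by apply/andP; split; [apply: contraTneq isT => ey; subst y; lia | lia].
move=> x x'; rewrite !in_rgt => /andP[/(in_level chXY) kx bx].
move=> /andP[/(in_level chXY) kx' bx'] eX; apply: (chart_inj chXY);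
  by move: (in_corner x) (in_corner x'); rewrite /corner; lia.
Qed.

(** Pulling the shadow straight down misses the top-row point [z], whose upper cover is outside. *)
Lemma ltn_shadow_lft k :
    b0 + a1 <= k.+1 -> b1 <= k.+1 < b0 + b1 -> a1 < b1 ->
  #|upper_shadow (lft k)| < #|lft k|.
Proof.
move=> ks kb ab; have [|z [Xz Yz]] := @corner_ex (k.+1 - b1) b1.-1.
  by rewrite /corner; lia.
rewrite (cardsD1 z (lft k)) in_lft (level_in chXY) ?Xz; last by lia.
rewrite (_ : k.+1 - b1 < b0) ?add1n ?ltnS; last by lia.
have kL y : y \in upper_shadow (lft k) -> X y + Y y = k.+1 /\ X y < b0.
  case/(shadowP chXY) => x; rewrite in_lft => /andP[/(in_level chXY) kx xb].
  by move: (in_corner y); rewrite /step /corner; lia.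
apply: (leq_card_coord (X := X) (u := X)) => [y /kL[ky yb]|y y' /kL[ky _] /kL[ky' _] eX].
  have [x [Xx Yx]] : exists x, X x = X y /\ Y x = (Y y).-1.
    by apply: corner_ex; move: (in_corner y); rewrite /corner; lia.
  exists x => //; rewrite in_setD1 in_lft (level_in chXY); last by lia.
  apply/andP; split; last by lia.
  apply: contraTneq isT => ex; subst x.
  by move: (in_corner y); rewrite /corner; lia.
by apply: (chart_inj chXY); lia.
Qed.

(** Mirror image: pulling the shadow left misses the point of the last column. *)
Lemma ltn_shadow_rgt k :
    b0 + a1 <= k.+1 -> a0 <= k.+1 < a0 + a1 -> b0 < a0 ->
  #|upper_shadow (rgt k)| < #|rgt k|.
Proof.
move=> ks ka ab; have [|z [Xz Yz]] := @corner_ex a0.-1 (k.+1 - a0).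
  by rewrite /corner; lia.
rewrite (cardsD1 z (rgt k)) in_rgt (level_in chXY) ?Xz; last by lia.
rewrite (_ : b0 <= a0.-1) ?add1n ?ltnS; last by lia.
have kR y : y \in upper_shadow (rgt k) -> X y + Y y = k.+1 /\ b0 < X y.
  case/(shadowP chXY) => x; rewrite in_rgt => /andP[/(in_level chXY) kx xb].
  by move: (in_corner y); rewrite /step /corner; lia.
apply: (leq_card_coord (X := X) (u := fun y => (X y).-1)).
  move=> y /kR[ky yb].
  have [x [Xx Yx]] : exists x, X x = (X y).-1 /\ Y x = Y y.
    by apply: corner_ex; move: (in_corner y); rewrite /corner; lia.
  exists x => //; rewrite in_setD1 in_rgt (level_in chXY); last by lia.
  apply/andP; split; last by lia.
  apply: contraTneq isT => ex; subst x.
  by move: (in_corner y); rewrite /corner; lia.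
by move=> y y' /kR[ky yb] /kR[ky' yb'] eX; apply: (chart_inj chXY); lia.
Qed.

(* Once both ends of the level are blocked, the cheapest set with as many points
   as the shorter right component is that component itself; but the left end was
   blocked first, which forced the initial segments to start on the left. *)
Lemma not_macaulay_corner :
    0 < a1 -> b0 < a0 -> a1 < b1 -> b1 < a0 -> a0 + a1 < b0 + b1 ->
  ~ macaulay T.
Proof.
move=> a1p ba ab b1a0 sab [tle [tleT tleA tleTr tleM]].
have cardS := card_Seg tleT tleA tleTr.
have SegS k A : A \subset level T k -> #|Seg tle k #|A| | = #|A|.
  by move=> /subset_leq_card /cardS.
have Seg1 k : (exists x, x \in level T k) -> exists x, x \in Seg tle k 1.
  case=> x xk; have /cardS/eqP/cards1P[y ->] : 0 < #|level T k|.
    by rewrite card_gt0; apply/set0Pn; exists x.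
  by exists y; rewrite inE.
have shSeg1 k A : A \subset level T k ->
    (exists y, y \in upper_shadow (Seg tle k #|A|)) ->
    Seg tle k.+1 1 \subset upper_shadow (Seg tle k #|A|).
  move=> Ak [y yS]; rewrite (tleM k A Ak).2; apply: Seg_mono.
  by rewrite card_gt0; apply/set0Pn; exists y.
(* The first rank at which the right end is blocked and the level is split. *)
pose k := maxn a0.-1 (b0 + a1).-1.
have ks : b0 + a1 <= k.+1 by lia.
have ka : a0 <= k.+1 by lia.
have kaa : k.+1 < a0 + a1 by lia.
have ltRL := ltn_card_rgt_lft ks.
(* [rgt k] has a shadow smaller than itself. A segment of the same size can match this only by
   containing a component, and [lft k] is too large. *)
have eR : Seg tle k #|rgt k| = rgt k.
  have Rk := rgt_sub_level k.
  have RS : rgt k \subset Seg tle k #|rgt k|.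
    apply/negPn/negP => nR.
    have := leq_shadow_split ks (Seg_sub_level tle k _) (Or33 _ _ _) (Or33 _ _ nR).
    rewrite SegS // => le; have := (tleM _ _ Rk).1; apply/negP; rewrite -ltnNge.
    apply: leq_trans (ltn_shadow_rgt ks _ ba) (le _); first by lia.
    apply/negP => /subset_leq_card; rewrite SegS //; apply/negP; rewrite -ltnNge.
    by apply: ltRL; lia.
  by apply/eqP; rewrite eq_sym eqEcard RS SegS // leqnn.
suff [x xS xb] : exists2 x, x \in Seg tle k 1 & X x < b0.
  have [y yR] := rgt_ex ka ks kaa.
  have : x \in rgt k.
    rewrite -eR; apply: subsetP (Seg_mono _ _ _) _ xS.
    by rewrite card_gt0; apply/set0Pn; exists y.
  by rewrite in_rgt leqNgt xb andbF.
(* If the corner appears before the right end is blocked, [k] is [a0.-1], and one rank lower only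
   the left component is blocked at both ends. It is a segment there, and by (ii) its shadow
   contains the largest element of level [k]. *)
have [la|la] := ltnP (b0 + a1) a0.
  have [ks' kb'] : b0 + a1 <= a0.-2.+1 /\ b1 <= a0.-2.+1 < b0 + b1 by lia.
  have Lk := lft_sub_level a0.-2.
  have ek : k = a0.-2.+1 by lia.
  have eL : Seg tle a0.-2 #|lft a0.-2| = lft a0.-2.
    have LS : lft a0.-2 \subset Seg tle a0.-2 #|lft a0.-2|.
      apply/negPn/negP => nL.
      have := leq_shadow_split ks' (Seg_sub_level tle _ _) (Or33 _ _ nL) (Or31 _ _ _).
      rewrite SegS // => le; have := (tleM _ _ Lk).1; apply/negP; rewrite -ltnNge.
      by apply: leq_trans (ltn_shadow_lft ks' kb' ab) (le _); lia.
    by apply/eqP; rewrite eq_sym eqEcard LS SegS // leqnn.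
  have [x xS] : exists x, x \in Seg tle k 1.
    by apply: Seg1; have [y] := rgt_ex ka ks kaa; rewrite in_rgt => /andP[yk _]; exists y.
  exists x => //; have : x \in upper_shadow (lft a0.-2).
    rewrite -eL; apply: (subsetP (shSeg1 _ _ Lk _)); last by rewrite -ek.
    have [y [Xy Yy]] : exists y, X y = b0.-1 /\ Y y = k.+1 - b0.
      by apply: corner_ex; rewrite /corner; lia.
    have [z' [Xz' Yz']] : exists z', X z' = b0.-1 /\ Y z' = (k.+1 - b0).-1.
      by apply: corner_ex; rewrite /corner; lia.
    exists y; rewrite eL; apply/(shadowP chXY); exists z'; last by rewrite /step; lia.
    by rewrite in_lft (level_in chXY); lia.
  case/(shadowP chXY) => z; rewrite in_lft => /andP[/(in_level chXY) kz zb].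
  by move: (in_corner x); rewrite /step /corner; lia.
(* Otherwise [k] is [(b0 + a1).-1]. At rank [a0.-2] only the top-row point lacks a second cover, so
   by (i) it is the largest element. Its only cover stays in row [b1.-1] and by (ii) is the largest
   element one rank higher, and so on up to [k]. *)
have Y1 m : a0.-2 + m <= (b0 + a1).-1 ->
    forall x, x \in Seg tle (a0.-2 + m) 1 -> Y x = b1.-1.
  elim: m => [|m IHm] ms x.
    rewrite addn0 => xS; have kx := in_level chXY (subsetP (Seg_sub_level _ _ _) _ xS).
    have [z [Xz Yz]] : exists z, X z = a0.-1 - b1 /\ Y z = b1.-1.
      by apply: corner_ex; rewrite /corner; lia.
    have zk : [set z] \subset level T a0.-2.
      by rewrite sub1set (level_in chXY); lia.
    have := (tleM _ _ zk).1; rewrite cards1 => le1.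
    have /card_le1_eqP sh1 : #|upper_shadow (Seg tle a0.-2 1)| <= 1.
      apply: leq_trans le1 _; apply/card_le1_eqP => y y'.
      case/(shadowP chXY) => t /set1P-> ty /(shadowP chXY)[t' /set1P-> ty'].
      apply: (chart_inj chXY); move: ty ty' (in_corner y) (in_corner y');
        by rewrite /step /corner; lia.
    have [//|nYx] := eqVneq (Y x) b1.-1.
    have [y [Xy Yy]] : exists y, X y = (X x).+1 /\ Y y = Y x.
      by apply: corner_ex; move: (in_corner x); rewrite /corner; lia.
    have [y' [Xy' Yy']] : exists y', X y' = X x /\ Y y' = (Y x).+1.
      by apply: corner_ex; move: (in_corner x); rewrite /corner; lia.
    have eyy' : y = y'.
      by apply: sh1; apply/(shadowP chXY); exists x => //; rewrite /step; lia.
    by subst y'; lia.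
  have ms' : a0.-2 + m <= (b0 + a1).-1 by lia.
  have [z [Xz Yz]] : exists z, X z = a0.-1 + m - b1 /\ Y z = b1.-1.
    by apply: corner_ex; rewrite /corner; lia.
  have zk : z \in level T (a0.-2 + m) by rewrite (level_in chXY); lia.
  have [t tS] := Seg1 _ (ex_intro _ z zk); have Yt := IHm ms' _ tS.
  have kt := in_level chXY (subsetP (Seg_sub_level _ _ _) _ tS).
  have [y [Xy Yy]] : exists y, X y = (X t).+1 /\ Y y = Y t.
    by apply: corner_ex; rewrite /corner; lia.
  have zk1 : [set z] \subset level T (a0.-2 + m) by rewrite sub1set.
  rewrite addnS => xS; have := shSeg1 _ _ zk1; rewrite cards1 => /(_ _)/subsetP sub.
  have /(shadowP chXY)[z' z'S z'x] : x \in upper_shadow (Seg tle (a0.-2 + m) 1).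
    by apply: sub xS; exists y; apply/(shadowP chXY); exists t => //; right.
  by have := IHm ms' _ z'S; move: z'x (in_corner x); rewrite /step /corner; lia.
have [x xS] : exists x, x \in Seg tle k 1.
  by apply: Seg1; have [y] := rgt_ex ka ks kaa; rewrite in_rgt => /andP[yk _]; exists y.
exists x => //; have := Y1 (k - a0.-2); rewrite subnKC; last by lia.
move=> /(_ _ x xS) Yx; move: (in_corner x); rewrite /corner; lia.
Qed.

End Corner.

(** * Transfer to the fiber product, using the symmetries of the region *)

Section Exponents.

Variables (a0 a1 b0 b1 : nat).

Lemma fiber_chart : chart (corner a0 a1 b0 b1)
  (fun x : fiber_product (CL_incl (geq_minl a0 b0) (geq_minl a1 b1))
                         (CL_incl (geq_minr a0 b0) (geq_minr a1 b1)) =>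
     (fiber_exp x).1)
  (fun x => (fiber_exp x).2).
Proof.
split=> [x y|x|x|i j].
- exact: fiber_exp_le.
- exact: fiber_exp_rk.
- by apply/fiber_expP; exists x; case: (fiber_exp x).
by case/fiber_expP => x ex; exists x; rewrite ex.
Qed.

End Exponents.

Lemma corner_swap a0 a1 b0 b1 i j : corner a0 a1 b0 b1 j i = corner b1 b0 a1 a0 i j.
Proof. by rewrite /corner; lia. Qed.

Lemma cornerC a0 a1 b0 b1 i j : corner a0 a1 b0 b1 i j = corner b0 b1 a0 a1 i j.
Proof. by rewrite /corner orbC. Qed.

Section Symmetry.

Variables (d : Order.disp_t) (T : rankedPosetType d) (X Y : T -> nat).

(** A rectangle is the degenerate region whose two rectangles coincide; transposing it if necessary
    makes it at least as wide as tall. *)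
Lemma macaulay_rectangle a0 a1 b0 b1 :
    chart (corner a0 a1 b0 b1) X Y -> b0 <= a0 -> b1 <= a1 -> macaulay T.
Proof.
move=> ch ba0 ba1.
have ch0 : chart (corner a0 a1 a0 a1) X Y.
  by apply: chart_ext ch => i j; rewrite /corner; lia.
case/orP: (leq_total a1 a0) => aa; first exact: macaulay_corner_suff ch0 _ _.
have ch1 := chart_ext (corner_swap _ _ _ _) (chart_swap ch0).
by apply: macaulay_corner_suff ch1 _ _; lia.
Qed.

(** Transposition exchanges [a0], [a1] with [b1], [b0], so the results for [b1 <= a0] also settle
    [a0 <= b1]. *)
Lemma macaulay_corner_iff a0 a1 b0 b1 :
    chart (corner a0 a1 b0 b1) X Y -> 0 < a1 -> 0 < b0 -> b0 < a0 -> a1 < b1 ->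
  macaulay T <->
  [\/ a0 = b1, b1 < a0 /\ b1 + b0 <= a0 + a1 | a0 < b1 /\ a0 + a1 <= b0 + b1].
Proof.
move=> ch a1p b0p ba ab.
have ch1 := chart_ext (corner_swap _ _ _ _) (chart_swap ch).
split=> [M|H].
  have [ab1|ba1|->] := ltngtP a0 b1; last exact: Or31.
    have [le|gt] := leqP (a0 + a1) (b0 + b1); first by apply: Or33.
    by case: (not_macaulay_corner _ _ ch1 _ _ _ _ _ M); lia.
  have [le|gt] := leqP (b1 + b0) (a0 + a1); first by apply: Or32.
  by case: (not_macaulay_corner _ _ ch _ _ _ _ _ M); lia.
(* For [a0 = b1] both weak inequalities hold, and the sums compare in one direction or the other. *)
have [[h1 h2]|[h1 h2]] :
  (b1 <= a0 /\ b0 + b1 <= a0 + a1) \/ (a0 <= b1 /\ a1 + a0 <= b1 + b0) by case: H; lia.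
  exact: (macaulay_corner_suff (ltnW ba) (ltnW ab) ch).
exact: (macaulay_corner_suff (ltnW ab) (ltnW ba) ch1).
Qed.

End Symmetry.

Theorem theorem3 (a0 a1 b0 b1 : nat)
    (a0_gt0 : 0 < a0) (a1_gt0 : 0 < a1) (b0_gt0 : 0 < b0) (b1_gt0 : 0 < b1) :
  macaulay (fiber_product
    (CL_incl (geq_minl a0 b0) (geq_minl a1 b1))
    (CL_incl (geq_minr a0 b0) (geq_minr a1 b1)))
  <->
  [\/ a0 <= b0 /\ a1 <= b1,
      b0 <= a0 /\ b1 <= a1,
      [/\ b0 < a0, a1 < b1 &
        [\/ a0 = b1,
            b1 < a0 /\ b1 + b0 <= a0 + a1 |
            a0 < b1 /\ a0 + a1 <= b0 + b1]] |
      [/\ a0 < b0, b1 < a1 &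
        [\/ b0 = a1,
            a1 < b0 /\ a1 + a0 <= b0 + b1 |
            b0 < a1 /\ b0 + b1 <= a0 + a1]]].
Proof.
have ch := @fiber_chart a0 a1 b0 b1; have ch' := chart_ext (cornerC _ _ _ _) ch.
split=> [M|].
  have [ab0|ba0] := leqP a0 b0; have [ab1|ba1] := leqP a1 b1.
  - exact: Or41.
  (* Equal widths give a containment, covered by the second alternative. *)
  - have [->|lt] := eqVneq a0 b0; first by apply: Or42; rewrite leqnn ltnW.
    apply: Or44; split=> //; first by lia.
    have ab : a0 < b0 by lia.
    exact: (macaulay_corner_iff ch' b1_gt0 a0_gt0 ab ba1).1 M.
  - have [->|lt] := eqVneq a1 b1; first by apply: Or42; rewrite leqnn ltnW.
    apply: Or43; split=> //; first by lia.
    have ab : a1 < b1 by lia.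
    exact: (macaulay_corner_iff ch a1_gt0 b0_gt0 ba0 ab).1 M.
  - by apply: Or42; split; apply: ltnW.
case=> [[ab0 ab1]|[ba0 ba1]|[ba ab H]|[ab ba H]].
- exact: macaulay_rectangle ch' ab0 ab1.
- exact: macaulay_rectangle ch ba0 ba1.
- exact: (macaulay_corner_iff ch a1_gt0 b0_gt0 ba ab).2 H.
- exact: (macaulay_corner_iff ch' b1_gt0 a0_gt0 ab ba).2 H.
Qed.
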